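(* Let $\mathcal{A}\subseteq B(\mathcal{H})$ be a von Neumann algebra and let $e_1,\dots,e_n\in\mathcal{A}$ be orthogonal projections such that $e_1+\cdots+e_n=I$. If $y\in\mathcal{A}$ is a strictly positive operator, then there exists $x\in\mathcal{A}$ such that $y=xx^\star$ and $x$ is upper triangular with respect to $e_1,\dots,e_n$, i.e. $e_ixe_j=0$ for all $i>j$.
   Context: A strictly positive operator is one that is positive and invertible (bounded below by $\epsilon I$ for some $\epsilon>0$). *)

(* Defs.v *)
From mathcomp Require Export all_boot all_order all_algebra complex.
From mathcomp Require Export all_classical all_reals all_analysis.
From mathcomp Require Import ring lra.
Export numFieldNormedType.Exports.
Export Order.TTheory GRing.Theory Num.Theory.

Set Implicit Arguments.
Unset Strict Implicit.
Unset Printing Implicit Defensive.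

Local Open Scope classical_set_scope.
Local Open Scope ring_scope.
Local Open Scope complex_scope.

(* Inner products are linear in the first variable and conjugate-linear in   *)
(* the second.  A complex Hilbert space is a complete normed R[i]-module H   *)
(* with ip : {dot H for conjC} such that [norm_of_ip ip].                    *)
Definition norm_of_ip (R : realType) (H : completeNormedModType R[i])
    (ip : {dot H for @Num.conj R[i]}) : Prop :=
  forall v : H, `|v| ^+ 2 = ip v v.

Section Operators.
Context {R : realType} {H : completeNormedModType R[i]}.
Implicit Types (S T : H -> H) (A : set (H -> H)).

(* The set B(H), with operators encoded as functions H -> H: addition,       *)
(* scaling and 0 are pointwise, the product is \o, the identity is idfun.    *)
Definition bounded_op : set (H -> H) :=
  [set T | linear T /\ exists M : R[i], forall v, `|T v| <= M * `|v|].

Definition invertible_op T : Prop :=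
  exists2 S, bounded_op S & T \o S = idfun /\ S \o T = idfun.

Variable ip : {dot H for @Num.conj R[i]}.

Definition is_adjoint T S : Prop :=
  bounded_op S /\ forall u v, ip (T u) v = ip u (S v).

(* The value is meaningful for T in B(H) only: there, by [adjointP] and      *)
(* [is_adjoint_uniq] below, it is the unique adjoint of T.                   *)
Definition adjoint T : H -> H := xget 0 (is_adjoint T).

Definition positive_op T : Prop :=
  bounded_op T /\ forall v, 0 <= ip (T v) v.

Definition strictly_positive_op T : Prop :=
  positive_op T /\ invertible_op T.

Definition orthogonal_projection T : Prop :=
  [/\ bounded_op T, T \o T = T & adjoint T = T].

Definition matrix_coef T : {ptws H * H -> R[i]^o} :=
  fun uv => ip (T uv.1) uv.2.

(* The weak operator topology, on all functions H -> H; on B(H) it induces   *)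
(* the usual one.                                                            *)
Definition wot : topologicalType := initial_topology matrix_coef.

(* A unital *-subalgebra of B(H) that is closed in B(H) for the weak         *)
(* operator topology.                                                        *)
Record von_neumann_algebra A : Prop := {
  vna_bounded : A `<=` bounded_op ;
  vna_id : A idfun ;
  vna_add : forall S T, A S -> A T -> A (S + T) ;
  vna_scale : forall (c : R[i]) T, A T -> A (c *: T) ;
  vna_comp : forall S T, A S -> A T -> A (S \o T) ;
  vna_adjoint : forall T, A T -> A (adjoint T) ;
  vna_closed : bounded_op `&` closure (A : set wot) `<=` A }.

End Operators.

Lemma quad_disc (R : realFieldType) (d g n : R) : 0 <= n -> 
  (forall t, 0 <= d + 2 * t * g + t ^+ 2 * n) -> g ^+ 2 <= d * n.
Proof.
rewrite le_eqVlt => /predU1P[<- | n0] h.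
  rewrite mulr0; have [->|g0] := eqVneq g 0; first by rewrite expr0n.
  have := h (- (d + 1) / (2 * g)).
  rewrite mulr0 addr0 (_ : _ + _ = -1) ?ler0N1// .
    by field.
have := h (- g / n).
rewrite (_ : _ + _ + _ = d - g ^+ 2 / n); last by field; rewrite gt_eqF.
by rewrite subr_ge0 ler_pdivrMr.
Qed.

Section Riesz.
Variables (R : realType) (H : completeNormedModType R[i]).
Variables (ip : {dot H for @Num.conj R[i]}) (ipN : norm_of_ip ip).

Let N (v : H) : R := complex.Re (ip v v).
Let B (u v : H) : R := complex.Re (ip u v).

Let ReD (a b : R[i]) : complex.Re (a + b) = complex.Re a + complex.Re b.
Proof. by case: a b => ? ? []. Qed.
Let ReM (t : R) (b : R[i]) : complex.Re (t%:C * b) = t * complex.Re b.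
Proof. by case: b => ? ? /=; rewrite mul0r subr0. Qed.

Let BC u v : B u v = B v u.
Proof. by rewrite /B hermC expr0 mul1r; change (complex.Re (conjc (ip v u)) = complex.Re (ip v u)); case: (ip v u). Qed.
Let BDl u v w : B (u + v) w = B u w + B v w.
Proof. by rewrite /B linearDl ReD. Qed.
Let BZl t u w : B (t%:C *: u) w = t * B u w.
Proof. by rewrite /B linearZl_LR ReM. Qed.
Let BDr u v w : B w (u + v) = B w u + B w v.
Proof. by rewrite BC BDl !(BC w). Qed.
Let BZr t u w : B w (t%:C *: u) = t * B w u.
Proof. by rewrite BC BZl (BC w). Qed.
Let ipNE v : ip v v = (N v)%:C.
Proof. by rewrite /N RRe_real// ger0_real// dnorm_ge0. Qed.
Let N0 v : 0 <= N v.
Proof. by have := dnorm_ge0 ip v; rewrite ipNE ler0c. Qed.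
Let NE v : `|v| = (Num.sqrt (N v))%:C.
Proof.
apply/eqP; rewrite -(@eqrXn2 _ 2)// ?ler0c ?sqrtr_ge0//.
by rewrite ipN -rmorphXn/= sqr_sqrtr// ipNE.
Qed.
Let ND u v : N (u + v) = N u + 2 * B u v + N v.
Proof. rewrite /N -!/(B _ _) BDl !BDr (BC v u); ring. Qed.
Let NZ t u : N (t%:C *: u) = t ^+ 2 * N u.
Proof. rewrite /N -!/(B _ _) BZl BZr; ring. Qed.
Let CS u v : B u v ^+ 2 <= N u * N v.
Proof.
apply: quad_disc => // t; have := N0 (u + t%:C *: v).
by rewrite ND NZ BZr mulrA.
Qed.
Let normlt v (e : R) : 0 < e -> (`|v| < e%:C) = (N v < e ^+ 2).
Proof.
move=> e0; rewrite NE ltcR -(@ltr_pXn2r _ 2)// ?sqr_sqrtr ?nnegrE ?sqrtr_ge0//.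
exact: ltW.
Qed.

Section functional.
Variable (f : H -> R[i]).
Hypothesis fl : forall a u v, f (a *: u + v) = a * f u + f v.
Variable c : R.
Hypothesis fb : forall u, complex.Re (f u) ^+ 2 <= c * N u.
Let F u := complex.Re (f u).
Let FD u v : F (u + v) = F u + F v.
Proof. by rewrite /F -{1}[u]scale1r fl mul1r ReD. Qed.
Let f0 : f 0 = 0.
Proof. by have /eqP := fl (-1) 0 0; rewrite scaler0 addr0 mulN1r addNr => /eqP. Qed.
Let FZ t u : F (t%:C *: u) = t * F u.
Proof. by rewrite /F -[_ *: _]addr0 fl f0 addr0 ReM. Qed.
Let J v := N v - 2 * F v.
Let Jlb v : - `|c| <= J v.
Proof.
have h : F v ^+ 2 <= `|c| * N v.
  by apply: le_trans (fb v) _; rewrite ler_wpM2r// ler_norm.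
rewrite /J; have := N0 v; have := normr_ge0 c; move: h.
move: (`|c|) (N v) (F v) => a n r h a0 n0.
suff : 2 * r <= n + a by lra.
rewrite real_leNgt ?num_real//; apply/negP => k.
have : (n + a) ^+ 2 < (2 * r) ^+ 2 by rewrite ltr_pXn2r// ?nnegrE; lra.
have : 0 <= (n - a) ^+ 2 by exact: sqr_ge0.
nra.
Qed.
Let j := inf (range J).
Let hasinf : has_inf (range J).
Proof. by split; [exists (J 0); exists 0|exists (- `|c|) => _ [v _ <-]]. Qed.
Let jle v : j <= J v.
Proof. by apply: ge_inf; [case: hasinf|exists v]. Qed.
Let seqP (k : nat) : exists v, J v < j + k.+1%:R^-1.
Proof.
by have [|_ [v _ <-] h] := @inf_adherent R _ k.+1%:R^-1 _ hasinf; [rewrite invr_gt0|exists v].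
Qed.

Let key d v h : J v < j + d -> (B h v - F h) ^+ 2 <= d * N h.
Proof.
move=> Jv; apply: quad_disc => // t.
have := jle (v + t%:C *: h); rewrite /J ND FD NZ FZ BZr (BC h).
move: Jv; rewrite /J; lra.
Qed.

Let para u v d : J u < j + d -> J v < j + d -> N (u - v) <= 4 * d.
Proof.
move=> Ju Jv; have := jle ((2^-1)%:C *: (u + v)).
rewrite -(scale1r v) -scaleNr (_ : -1 = (-1)%:C); last by rewrite rmorphN1.
move: Ju Jv; rewrite /J FZ NZ !ND !NZ FD !BZr scale1r !expr2.
lra.
Qed.

Lemma riesz_real_part : exists w, forall h, F h = B h w.
Proof.
have [a aP] := choice seqP.
have aJ (e : R) : 0 < e -> exists K, forall k, (K <= k)%N -> J (a k) < j + e.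
  move=> e0; exists (Num.truncn e^-1) => k Kk; apply: lt_le_trans (aP k) _.
  rewrite lerD2l -[leRHS]invrK lef_pV2 ?posrE ?invr_gt0 //.
  have := truncnS_gt e^-1 => h; apply/ltW/(lt_le_trans h).
  by rewrite ler_nat ltnS.
have posC (e : R[i]) : 0 < e -> exists2 r : R, 0 < r & e = r%:C.
  move=> e0; exists (complex.Re e); last by rewrite RRe_real// gtr0_real.
  by rewrite -ltcR RRe_real ?gtr0_real.
have : cauchy (a @ \oo).
  apply/cauchy_exP => e /posC[r r0 ->].
  have [|K KP] := aJ (r ^+ 2 / 8); first by rewrite divr_gt0// exprn_gt0.
  exists (a K); exists K => // k /= Kk; rewrite -ball_normE /ball_/= normlt//.
  apply: le_lt_trans (para (KP _ _) (KP _ _)) _ => //.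
  have : 0 < r ^+ 2 by rewrite exprn_gt0.
  lra.
move=> /cauchy_cvg /cvg_ex[w aw]; exists w => h.
apply/eqP; rewrite eq_sym -subr_eq0 -normr_le0; apply/ler_addgt0Pr => e e0.
rewrite add0r.
pose n := Num.sqrt (N h) + 1; have n0 : 0 < n.
  by rewrite ltr_wpDl// sqrtr_ge0.
have Nn : N h <= n ^+ 2.
  rewrite -[leLHS]sqr_sqrtr// lerXn2r ?nnegrE ?sqrtr_ge0//.
    by rewrite ltW.
  by rewrite lerDl.
pose d := e / 2 / n; have d0 : 0 < d by rewrite !divr_gt0.
have [|K KP] := aJ (d ^+ 2); first by rewrite exprn_gt0.
have /cvgrPdist_lt/(_ d%:C)[|K' _ KP'] := aw; first by rewrite ltcR.
pose k := maxn K K'.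
have h1 := key h (KP k (leq_maxl _ _)).
have h2 : `|w - a k| < d%:C by apply: KP' => /=; exact: leq_maxr.
rewrite normlt// in h2.
have h3 := CS h (w - a k).
have sq (x : R) : x ^+ 2 <= d ^+ 2 * n ^+ 2 -> `|x| <= e / 2.
  rewrite -exprMn /d divfK ?gt_eqF// => hx.
  by rewrite -(@ler_pXn2r _ 2)// ?nnegrE ?real_normK ?num_real// divr_ge0// ltW.
have -> : B h w - F h = (B h (a k) - F h) + B h (w - a k).
  by rewrite -{1}(subrK (a k) w) BDr; lra.
apply: le_trans (ler_normD _ _) _; rewrite (splitr e) lerD//; apply: sq.
  by apply: le_trans h1 _; rewrite ler_wpM2l// sqr_ge0.
apply: le_trans h3 _; rewrite mulrC ler_pM//; exact: ltW.
Qed.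

Lemma riesz_representation : exists w, forall h, f h = ip h w.
Proof.
have [w wP] := riesz_real_part; exists w => h.
have h1 := wP h; have h2 := wP ('i *: h).
move: h2; rewrite /F /B linearZl_LR -[_ *: _]addr0 fl f0 addr0.
move: h1; rewrite /F /B /=.
case: (f h) (ip h w) => [x y] [x' y'] /= ->.
by rewrite !mul0r !mul1r !sub0r => /oppr_inj ->.
Qed.
End functional.

Lemma ip_inj v w : (forall u, ip u v = ip u w) -> v = w.
Proof.
move=> h; apply/eqP; rewrite -subr_eq0 -(dnorm_eq0 ip) linearBr/=.
by rewrite h subrr.
Qed.

Lemma is_adjoint_uniq T S1 S2 :
  is_adjoint ip T S1 -> is_adjoint ip T S2 -> S1 = S2.
Proof.
move=> [_ h1] [_ h2]; apply/funext => v; apply: ip_inj => u.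
by rewrite -h1 -h2.
Qed.

Lemma adjointP T : bounded_op T -> is_adjoint ip T (adjoint ip T).
Proof.
move=> [Tl [M TM]]; apply: (@xgetPex _ 0 (is_adjoint ip T)).
pose m := complex.Re `|M|.
have mE : `|M| = m%:C by rewrite RRe_real ?ger0_real.
have m0 : 0 <= m by rewrite -ler0c -mE.
have NT u : N (T u) <= m ^+ 2 * N u.
  have : `|T u| <= `|M| * `|u|.
    have := TM u; rewrite -[X in _ <= X]ger0_norm ?normrM ?normr_id//.
    exact: le_trans (TM u).
  rewrite mE !NE -rmorphM lecR -(@ler_pXn2r _ 2)// ?nnegrE ?sqrtr_ge0//.
    by rewrite exprMn !sqr_sqrtr.
  by rewrite mulr_ge0 ?sqrtr_ge0.
have ex v : exists w, forall u, ip (T u) v = ip u w.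
  apply: (@riesz_representation (fun u => ip (T u) v) _ (m ^+ 2 * N v)) => [a u w|u].
    by rewrite Tl linearDl linearZl_LR.
  apply: le_trans (CS (T u) v) _.
  by rewrite mulrAC ler_wpM2r.
have [S SP] := choice ex; exists S; split; last by move=> u v; exact: SP.
split.
  move=> a u v; apply: ip_inj => x.
  by rewrite -SP !linearDr !linearZr_LR /= !SP.
exists m%:C => v; rewrite !NE -rmorphM lecR.
have h : N (S v) ^+ 2 <= (m ^+ 2 * N v) * N (S v).
  have := CS (T (S v)) v; rewrite /B SP -/(N _) => /le_trans; apply.
  by rewrite mulrAC ler_wpM2r.
rewrite -(@ler_pXn2r _ 2)// ?nnegrE ?sqrtr_ge0// ?mulr_ge0 ?sqrtr_ge0//.
rewrite exprMn !sqr_sqrtr//.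
have := N0 (S v); rewrite le_eqVlt => /predU1P[<-|SN].
  by rewrite mulr_ge0 ?sqr_ge0.
by rewrite expr2 ler_pM2r in h.
Qed.
End Riesz.

(* Main.v *)
(* Cholesky factorization, one block at a time from the last one.  Put        *)
(* p = e_k and let s be the inverse square root of p y p + (1 - p): it lies   *)
(* in A, is self-adjoint and commutes with p.  The column c = y s p satisfies *)
(* c c* = y p (p y p)^-1 p y, so y - c c* is the Schur complement of y: it is *)
(* killed by p and keeps the lower bound of y on the blocks i < k.  If it     *)
(* equals x x*, then y = (x + c)(x + c)*.                                     *)
(* The inverse square root comes from two fixed points of contractions on     *)
(* balls of A: for 0 <= a <= q < 1, x = (a + x^2) / 2 makes 1 - x a square    *)
(* root of 1 - a, and w = x + x w makes 1 + w the inverse of 1 - x.  Weak     *)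
(* closedness of A is only used through closedness under norm limits.         *)

From HB Require Import structures.
Require Import Defs.
From mathcomp Require Import ring lra.

Set Implicit Arguments.
Unset Strict Implicit.
Unset Printing Implicit Defensive.

Local Open Scope classical_set_scope.
Local Open Scope ring_scope.
Local Open Scope complex_scope.

(** The factor is built column by column by the induction in [triangular_factor], where [y] lives on
    the blocks [i <= k] and is at least [c] there. The column [y s p] is fed by block k alone, and
    its range avoids the blocks above k because that of [y] does; hence it is upper triangular.

    Subtracting the column times its adjoint completes the square in block k: the quadratic form of
    the remainder at [v] is that of [y] at [v] corrected by a vector of block k. The correction does
    not touch the earlier blocks, so the remainder keeps the lower bound [c] on them. This bound
    makes each corner p y p invertible; it starts from [strictly_positive_lower_bound].

    That [s] exists inside [A] and commutes with [p] is [vna_inv_sqrt]. It rescales the operator to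
    one near the identity and combines [vna_sqrt_near_id] and [vna_neumann], two instances of
    [contraction_fixpoint]; the limits stay in [A] by [vna_limit]. *)

Section HilbertSpace.
Context {R : realType} {H : completeNormedModType R[i]}.
Variables (ip : {dot H for @Num.conj R[i]}) (ipN : norm_of_ip ip).
Implicit Types (u v w : H) (S T : H -> H).

(** * Real-valued norm and inner product, Cauchy-Schwarz, symmetry of positive operators *)

Definition rnorm v : R := complex.Re `|v|.
Definition rip u v : R := complex.Re (ip u v).

Lemma rnormE v : `|v| = (rnorm v)%:C.
Proof. by rewrite /rnorm RRe_real. Qed.

Lemma rnorm_ge0 v : 0 <= rnorm v.
Proof. by rewrite -lecR -rnormE normr_ge0. Qed.

Lemma rnorm0 : rnorm 0 = 0.
Proof. by rewrite /rnorm normr0. Qed.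

Lemma rnorm_eq0 v : rnorm v = 0 -> v = 0.
Proof. by move=> h; apply/eqP; rewrite -normr_eq0 rnormE h. Qed.

Lemma rnormD u v : rnorm (u + v) <= rnorm u + rnorm v.
Proof. by rewrite -lecR rmorphD/= -!rnormE ler_normD. Qed.

Lemma rnormN v : rnorm (- v) = rnorm v.
Proof. by rewrite /rnorm normrN. Qed.

Lemma rnormB u v : rnorm (u - v) <= rnorm u + rnorm v.
Proof. by rewrite -(rnormN v) rnormD. Qed.

Lemma rdistC u v : rnorm (u - v) = rnorm (v - u).
Proof. by rewrite -rnormN opprB. Qed.

Lemma rnormZ (t : R) v : rnorm (t%:C *: v) = `|t| * rnorm v.
Proof.
apply: (@complexI R); rewrite -rnormE normrZ rmorphM/= -rnormE.
by rewrite normc_def/= expr0n/= addr0 sqrtr_sqr.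
Qed.

Lemma rnormZc (c : R[i]) v : rnorm (c *: v) = complex.Re `|c| * rnorm v.
Proof.
by apply: (@complexI R); rewrite -rnormE normrZ rmorphM/= -rnormE.
Qed.

Lemma ip_rnorm v : ip v v = (rnorm v ^+ 2)%:C.
Proof. by rewrite -ipN rnormE rmorphXn. Qed.

Lemma rip_rnorm v : rip v v = rnorm v ^+ 2.
Proof. by rewrite /rip ip_rnorm. Qed.

Lemma ReD (a b : R[i]) : complex.Re (a + b) = complex.Re a + complex.Re b.
Proof. by case: a b => ? ? []. Qed.

Lemma ReN (a : R[i]) : complex.Re (- a) = - complex.Re a.
Proof. by case: a. Qed.

Lemma ReM (t : R) (b : R[i]) : complex.Re (t%:C * b) = t * complex.Re b.
Proof. by case: b => ? ? /=; rewrite mul0r subr0. Qed.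

Lemma ipC u v : ip v u = Num.conj (ip u v).
Proof. by rewrite hermC expr0 mul1r. Qed.

Lemma ipDl u v w : ip (u + v) w = ip u w + ip v w.
Proof. exact: linearDl. Qed.

Lemma ipDr u v w : ip w (u + v) = ip w u + ip w v.
Proof. exact: linearDr. Qed.

Lemma ipZl a u v : ip (a *: u) v = a * ip u v.
Proof. exact: linearZl_LR. Qed.

Lemma ipZr a u v : ip u (a *: v) = Num.conj a * ip u v.
Proof. exact: linearZr_LR. Qed.

Lemma ipZr_real (t : R) u v : ip u (t%:C *: v) = t%:C * ip u v.
Proof. by rewrite ipZr; congr (_ * _); exact: conjc_real. Qed.

Lemma ripC u v : rip u v = rip v u.
Proof. by rewrite /rip ipC; case: (ip v u). Qed.

Lemma ripDl u v w : rip (u + v) w = rip u w + rip v w.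
Proof. by rewrite /rip linearDl ReD. Qed.

Lemma ripNl u w : rip (- u) w = - rip u w.
Proof. by rewrite /rip linearNl ReN. Qed.

Lemma ripZl t u w : rip (t%:C *: u) w = t * rip u w.
Proof. by rewrite /rip linearZl_LR ReM. Qed.

Lemma ripDr u v w : rip w (u + v) = rip w u + rip w v.
Proof. by rewrite ripC ripDl !(ripC w). Qed.

Lemma ripNr u w : rip w (- u) = - rip w u.
Proof. by rewrite ripC ripNl (ripC w). Qed.

Lemma ripZr t u w : rip w (t%:C *: u) = t * rip w u.
Proof. by rewrite ripC ripZl (ripC w). Qed.

Lemma rip_le u v : rip u v ^+ 2 <= rnorm u ^+ 2 * rnorm v ^+ 2.
Proof.
apply: quad_disc => [|t]; first exact: sqr_ge0.
have : 0 <= rip (u + t%:C *: v) (u + t%:C *: v) by rewrite rip_rnorm sqr_ge0.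
by rewrite ripDl !ripDr !ripZl !ripZr (ripC v) !rip_rnorm; lra.
Qed.

Lemma ip_le u v : `|ip u v| <= `|u| * `|v|.
Proof.
pose c := ip u v; pose r := complex.Re `|c|.
have cE : `|c| = r%:C by rewrite RRe_real// ger0_real.
have r0 : 0 <= r by rewrite -lecR -cE normr_ge0.
rewrite -/c cE !rnormE -rmorphM lecR.
(* Rotating and scaling [u] by the conjugate of c = <u, v> turns the inner product into the real
   number |c|^2; one factor |c|^2 then cancels. *)
have := rip_le (Num.conj c *: u) v.
rewrite rnormZc norm_conjC -/r {1}/rip linearZl_LR/= -/c [_ * c]mulrC -normCK cE -rmorphXn/=.
move=> h; rewrite -(@ler_pXn2r _ 2)// ?nnegrE ?mulr_ge0 ?rnorm_ge0//.
have := r0; rewrite le_eqVlt => /predU1P[<-|r1]; first by rewrite expr0n sqr_ge0.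
rewrite -(@ler_pM2l _ (r ^+ 2)) ?exprn_gt0//.
by move: h; rewrite !exprMn [X in _ -> _ <= X]mulrA.
Qed.

Lemma bounded_opP T : bounded_op T ->
  exists2 M : R, 0 <= M & forall v, rnorm (T v) <= M * rnorm v.
Proof.
move=> [_ [M TM]]; exists (complex.Re `|M|).
  by rewrite -lecR RRe_real ?normr_real ?normr_ge0.
move=> v; rewrite -lecR rmorphM/= RRe_real// -!rnormE.
have := TM v; rewrite -[X in _ <= X]ger0_norm ?normrM ?normr_id//.
exact: le_trans (TM v).
Qed.

Lemma linear_opE T : linear T -> exists f : {linear H -> H}, T = f.
Proof.
move=> Tl.
pose f : {linear H -> H} := HB.pack T (GRing.isLinear.Build _ _ _ _ T Tl).
by exists f.
Qed.

Definition symmetric_op T := forall u v, ip (T u) v = ip u (T v).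

(** Polarization: the defect [d] of symmetry vanishes on the diagonal since <T w, w> is real, so it
    is antisymmetric. Replacing [u] by i u shows that it is also symmetric, hence zero. *)
Lemma positive_symmetric T : positive_op ip T -> symmetric_op T.
Proof.
move=> [[Tl _] Tp] u v; have [f fE] := linear_opE Tl; move: Tp; rewrite {}fE => Tp.
pose d u v := ip (f u) v - ip u (f v).
have d0 w : d w w = 0.
  apply/eqP; rewrite subr_eq0 (ipC (f w)); apply/eqP/esym/CrealP.
  exact: ger0_real (Tp w).
have dD a b : d a b + d b a = 0.
  have -> : d a b + d b a = d (a + b) (a + b) - d a a - d b b.
    by rewrite /d (linearD f) !ipDl !ipDr; ring.
  by rewrite !d0 !subr0.
have h2 : d u v = d v u.
  apply: (@mulfI _ 'i%R); first exact: neq0Ci.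
  apply/eqP; rewrite -subr_eq0 -(dD ('i%R *: u) v) /d (linearZ_LR f).
  rewrite !ipZl !ipZr conjCi; apply/eqP; ring.
have := dD u v; rewrite -h2 -mulr2n => /eqP; rewrite mulrn_eq0/= subr_eq0.
exact/eqP.
Qed.

End HilbertSpace.

(** * Norm limits in a von Neumann algebra and a fixed point theorem for operators *)

Section VonNeumannAlgebra.
Context {R : realType} {H : completeNormedModType R[i]}.
Variables (ip : {dot H for @Num.conj R[i]}) (ipN : norm_of_ip ip).
Implicit Types (u v w : H) (S T X : H -> H) (A E : set (H -> H)).

Lemma vna_sub A S T : von_neumann_algebra ip A -> A S -> A T -> A (S - T).
Proof.
move=> vnA AS AT; rewrite -scaleN1r; apply: (vna_add vnA) => //.
exact: (vna_scale vnA).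
Qed.

Lemma vna0 A : von_neumann_algebra ip A -> A 0.
Proof.
by move=> vnA; rewrite -(subrr (@idfun H)); apply: vna_sub => //; exact: (vna_id vnA).
Qed.

(** By Cauchy-Schwarz, strong convergence forces every matrix coefficient to converge, which is
    convergence in [wot]. *)
Lemma vna_cvg A (S : nat -> H -> H) X : von_neumann_algebra ip A ->
  (forall k, A (S k)) -> bounded_op X ->
  (forall v (d : R), 0 < d ->
     exists k0, forall k, (k0 <= k)%N -> rnorm (X v - S k v) <= d) ->
  A X.
Proof.
move=> vnA AS bX SX; apply: (vna_closed vnA); split=> //.
have SXw : (S : nat -> wot ip) @ \oo --> (X : wot ip).
  move=> B /= [_ [[C oC <-] CX CB]]; apply: (filterS CB).
  have : (matrix_coef ip \o S) @ \oo --> matrix_coef ip X.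
    apply/pointwise_cvgP => -[u v]; apply/cvgrPdist_le => d d0.
    have dE : (complex.Re d)%:C = d by rewrite RRe_real ?gtr0_real.
    have d'0 : 0 < complex.Re d by rewrite -ltcR dE.
    have v0 : 0 < rnorm v + 1 by rewrite ltr_wpDl ?rnorm_ge0.
    have [|k0 hk] := SX u (complex.Re d / (rnorm v + 1)); first by rewrite divr_gt0.
    exists k0 => // k /= /hk {}hk; rewrite /matrix_coef /=.
    have -> : ip (X u) v - ip (S k u) v = ip (X u - S k u) v by rewrite linearBl.
    apply: le_trans (ip_le ipN _ _) _; rewrite !rnormE -rmorphM -dE lecR.
    apply: le_trans (_ : complex.Re d / (rnorm v + 1) * (rnorm v + 1) <= _).
      by apply: ler_pM; rewrite ?rnorm_ge0// lerDl.
    by rewrite divfK ?gt_eqF.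
  by apply; apply: open_nbhs_nbhs.
move=> B /SXw [k0 _ hB]; exists (S k0); split; first exact: AS.
exact: hB (leqnn k0).
Qed.

Lemma le0_small (x c : R) : (forall d, 0 < d -> x <= d * c) -> x <= 0.
Proof.
move=> h; apply/ler_addgt0Pr => d d0; rewrite add0r.
have c0 : 0 < `|c| + 1 by rewrite ltr_wpDl.
apply: le_trans (h (d / (`|c| + 1)) _) _; first by rewrite divr_gt0.
rewrite mulrAC ler_pdivrMr// ler_pM2l//.
by apply: le_trans (ler_norm c) _; rewrite lerDl.
Qed.

(** This expresses that the operator norm of S - T is at most [d], and makes sense before [S] or [T]
    is known to be bounded or linear. *)
Definition op_close (d : R) S T := forall v, rnorm (S v - T v) <= d * rnorm v.

Lemma small_eq u v (c : R) : (forall d : R, 0 < d -> rnorm (u - v) <= d * c) -> u = v.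
Proof.
move=> /le0_small h; apply/eqP; rewrite -subr_eq0; apply/eqP/rnorm_eq0/eqP.
by rewrite eq_le h rnorm_ge0.
Qed.

Lemma bounded_op_limit X :
  (forall d, 0 < d -> exists2 S, bounded_op S & op_close d X S) -> bounded_op X.
Proof.
move=> SX; split.
  move=> a u v.
  pose c := rnorm (a *: u + v) + complex.Re `|a| * rnorm u + rnorm v.
  apply: (@small_eq _ _ c) => d /SX[S [Sl _] hS].
  have [f fE] := linear_opE Sl; rewrite {}fE in hS.
  have -> : X (a *: u + v) - (a *: X u + X v) =
      (X (a *: u + v) - f (a *: u + v)) - (a *: (X u - f u) + (X v - f v)).
    by rewrite (linearP f) scalerBr addrACA -opprD opprB addrA subrK.
  apply: le_trans (rnormB _ _) _; rewrite /c !mulrDr -addrA lerD//.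
  apply: le_trans (rnormD _ _) _; rewrite lerD// rnormZc mulrCA.
  by rewrite ler_wpM2l// -lecR RRe_real ?normr_real ?normr_ge0.
have [S bS hS] := SX 1 ltr01.
have [M M0 hM] := bounded_opP bS.
exists (1 + M)%:C => v; rewrite !rnormE -rmorphM lecR -[X v](subrK (S v)).
apply: le_trans (rnormD _ _) _; rewrite mulrDl lerD//; exact: hS.
Qed.

Lemma vna_limit A X : von_neumann_algebra ip A ->
  (forall d, 0 < d -> exists2 S, A S & op_close d X S) -> A X.
Proof.
move=> vnA SX.
have bX : bounded_op X.
  by apply: bounded_op_limit => d /SX[S /(vna_bounded vnA) ? ?]; exists S.
have /choice[S hS] (k : nat) : exists T, A T /\ op_close k.+1%:R^-1 X T.
  by have [|T AT XT] := SX k.+1%:R^-1; [rewrite invr_gt0|exists T].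
apply: (@vna_cvg A S X) => // [k|v d d0]; first by have [] := hS k.
exists (Num.truncn (rnorm v / d)) => k hk; have [_ /(_ v)/le_trans] := hS k; apply.
rewrite mulrC ler_pdivrMr// mulrC -ler_pdivrMr//.
by apply/ltW/(lt_le_trans (truncnS_gt _)); rewrite ler_nat ltnS.
Qed.

(** Banach's fixed point theorem for the operator norm, iterating from 0. The bound [r] on [K]
    controls the first step, and the last hypothesis is closedness of [K] under norm limits. *)
Lemma contraction_fixpoint (K : set (H -> H)) (F : (H -> H) -> H -> H) (q r : R) :
  0 <= q -> q < 1 -> 0 <= r -> K 0 -> (forall T, K T -> K (F T)) ->
  (forall T, K T -> forall v, rnorm (T v) <= r * rnorm v) ->
  (forall S T d, K S -> K T -> 0 <= d -> op_close d S T ->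
     op_close (q * d) (F S) (F T)) ->
  (forall X, (forall d, 0 < d -> exists2 S, K S & op_close d X S) -> K X) ->
  exists2 X, K X & F X = X.
Proof.
move=> q0 q1 r0 K0 KF Kr Fq Kcl.
have q1' : 0 < 1 - q by rewrite subr_gt0.
(* [c k] is the tail of the geometric series of the step sizes r q^k, so it bounds the distance from
   [s k] to all later iterates. *)
pose s k := iter k F 0; pose c k := r / (1 - q) * q ^+ k.
have c_ge0 k : 0 <= c k by rewrite mulr_ge0 ?divr_ge0 ?exprn_ge0// ltW.
have Ks k : K (s k) by elim: k => //= k /KF.
have step k : op_close (r * q ^+ k) (s k.+1) (s k).
  elim: k => [|k IHk]; first by move=> v; rewrite expr0 mulr1 subr0; exact: Kr (Ks 1%N) v.
  by rewrite exprS mulrCA; apply: Fq IHk => //; rewrite mulr_ge0 ?exprn_ge0.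
have dist m k : op_close (c k) (s (k + m)%N) (s k).
  elim: m k => [|m IHm] k v.
    by rewrite addn0 subrr rnorm0 mulr_ge0 ?rnorm_ge0.
  rewrite addnS -addSn -[s _ v](subrK (s k.+1 v)) -addrA.
  apply: le_trans (rnormD _ _) _; apply: le_trans (lerD (IHm _ _) (step _ _)) _.
  rewrite -mulrDl ler_wpM2r ?rnorm_ge0// /c exprS.
  by rewrite le_eqVlt; apply/orP; left; apply/eqP; field; rewrite gt_eqF.
have c_small d : 0 < d -> exists k, c k <= d.
  move=> d0; have : geometric (r / (1 - q)) q @ \oo --> 0.
    by apply: cvg_geometric; rewrite ger0_norm.
  move=> /cvgrPdist_le/(_ _ d0)[k _ /(_ k (leqnn k))] /=.
  by rewrite sub0r normrN => h; exists k; apply: le_trans h; exact: ler_norm.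
have dist_lim v (d : R) : 0 < d ->
    exists k, forall n, (k <= n)%N -> rnorm (s n v - s k v) < d.
  move=> d0; have v0 : 0 < rnorm v + 1 by rewrite ltr_wpDl ?rnorm_ge0.
  have [|k ck] := c_small (d / (rnorm v + 1)); first by rewrite divr_gt0.
  exists k => n kn; have := dist (n - k)%N k v; rewrite subnKC// => /le_lt_trans; apply.
  apply: le_lt_trans (_ : d / (rnorm v + 1) * rnorm v < d).
    by rewrite ler_wpM2r ?rnorm_ge0.
  by rewrite mulrAC ltr_pdivrMr// ltr_pM2l// ltrDl.
have posC (d : R[i]) : 0 < d -> exists2 d' : R, 0 < d' & d = d'%:C.
  move=> d0; exists (complex.Re d); last by rewrite RRe_real// gtr0_real.
  by rewrite -ltcR RRe_real ?gtr0_real.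
(* The limit is taken vector by vector, using completeness of [H] only; the uniform bound [c k] then
   passes to it. *)
have /choice[X sX] : forall v, exists x : H, (fun k => s k v) @ \oo --> x.
  move=> v; suff /cauchy_cvg/cvg_ex : cauchy ((fun k => s k v) @ \oo) by [].
  apply/cauchy_exP => _ /posC[d d0 ->]; have [k hk] := dist_lim v d d0.
  exists (s k v), k => // n /= kn; rewrite -ball_normE /ball_/= rnormE ltcR rdistC.
  exact: hk.
have Xs k : op_close (c k) X (s k).
  move=> v; apply/ler_addgt0Pr => d d0.
  have /cvgrPdist_lt/(_ d%:C)[|k' _ hk'] := sX v; first by rewrite ltcR.
  have := hk' (k + k')%N (leq_addl _ _); rewrite /= rnormE ltcR => /ltW h.
  rewrite -[X v](subrK (s (k + k')%N v)) -addrA addrC.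
  by apply: le_trans (rnormD _ _) _; apply: lerD (dist _ _ _) h.
have KX : K X.
  apply: Kcl => d /c_small[k ck]; exists (s k) => // v.
  by apply: le_trans (Xs k v) _; rewrite ler_wpM2r ?rnorm_ge0.
exists X => //; apply/funext => v.
apply: (@small_eq _ _ (rnorm v + rnorm v)) => d /c_small[k ck].
have -> : F X v - X v = (F X v - F (s k) v) + (s k.+1 v - X v).
  by rewrite addrA subrK.
apply: le_trans (rnormD _ _) _; rewrite mulrDr lerD//.
  apply: le_trans (Fq _ _ _ KX (Ks k) (c_ge0 k) (Xs k) v) _.
  rewrite ler_wpM2r ?rnorm_ge0//; apply: le_trans ck.
  by rewrite ler_piMl// ltW.
rewrite rdistC; apply: le_trans (Xs _ _) _.
rewrite ler_wpM2r ?rnorm_ge0//; apply: le_trans ck.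
by rewrite /c exprS mulrCA ler_piMl ?(ltW q1)//; exact: c_ge0.
Qed.

End VonNeumannAlgebra.

(** * Inverse square roots inside the algebra, with control of commutation *)

Section InverseSquareRoot.
Context {R : realType} {H : completeNormedModType R[i]}.
Variables (ip : {dot H for @Num.conj R[i]}) (ipN : norm_of_ip ip).
Implicit Types (u v w : H) (S T X : H -> H) (A E : set (H -> H)).

Lemma rip_le_rnorm u v : rip ip u v <= rnorm u * rnorm v.
Proof.
apply: le_trans (ler_norm _) _.
rewrite -(@ler_pXn2r _ 2)// ?nnegrE ?mulr_ge0 ?rnorm_ge0//.
by rewrite real_normK ?num_real// exprMn; exact: rip_le.
Qed.

(* The Cauchy-Schwarz inequality of the semi-inner product [ip (T _) _],     *)
(* applied to [v] and [T v].                                                 *)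
Lemma rnorm_symmetric_le T (c : R) : linear T -> symmetric_op ip T ->
  (forall v, 0 <= rip ip (T v) v) ->
  (forall v, rip ip (T v) v <= c * rnorm v ^+ 2) ->
  forall v, rnorm (T v) ^+ 2 <= c * rip ip (T v) v.
Proof.
move=> /linear_opE[f ->] {T} fs f0 fc v.
have : rnorm (f v) ^+ 2 ^+ 2 <= rip ip (f v) v * rip ip (f (f v)) (f v).
  apply: quad_disc => // t; have := f0 (v + t%:C *: f v).
  rewrite (linearD f) (linearZ_LR f) !ripDl !ripDr !ripZl !ripZr.
  have -> : rip ip (f (f v)) v = rip ip (f v) (f v) by rewrite /rip fs.
  by rewrite (rip_rnorm ipN); lra.
move=> h; have [->|n0] := eqVneq (rnorm (f v)) 0.
  have [->|v0] := eqVneq v 0; first by rewrite expr0n /rip (linear0 f) linear0l mulr0.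
  have c0 : 0 <= c.
    have := le_trans (f0 v) (fc v); rewrite pmulr_lge0// exprn_gt0// lt_neqAle.
    by rewrite rnorm_ge0 andbT eq_sym; apply: contra v0 => /eqP/rnorm_eq0 ->.
  by rewrite expr0n mulr_ge0.
have n1 : 0 < rnorm (f v) ^+ 2 by rewrite exprn_gt0// lt_neqAle eq_sym n0 rnorm_ge0.
rewrite -(ler_pM2r n1) -expr2 (le_trans h)// -mulrA [X in _ <= X]mulrCA.
by rewrite ler_wpM2l.
Qed.

(** All four conditions survive norm limits, so fixed points inherit them. [E] records the operators
    with which the result must still commute. *)
Definition vna_ball A E (r : R) : set (H -> H) := [set T |
  [/\ A T, symmetric_op ip T, (forall f, E f -> forall v, T (f v) = f (T v)) &
      forall v, rnorm (T v) <= r * rnorm v]].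

Lemma vna_ball_limit A E (r : R) X : von_neumann_algebra ip A ->
  E `<=` bounded_op ->
  (forall d, 0 < d -> exists2 S, vna_ball A E r S & op_close d X S) ->
  vna_ball A E r X.
Proof.
move=> vnA bE SX; split.
- by apply: (vna_limit ipN vnA) => d /SX[S [? _ _ _] ?]; exists S.
- move=> u v; apply/eqP; rewrite -subr_eq0 -normr_le0.
  have xE : `|ip (X u) v - ip u (X v)| = (complex.Re `|ip (X u) v - ip u (X v)|)%:C.
    by rewrite RRe_real ?normr_real.
  rewrite xE lecR; apply: (@le0_small _ _ (rnorm u * rnorm v + rnorm u * rnorm v)).
  move=> d /SX[S [_ Ss _ _] hS]; rewrite -lecR -xE.
  have -> : ip (X u) v - ip u (X v) = ip (X u - S u) v - ip u (X v - S v).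
    by rewrite linearBl linearBr /= Ss opprB addrA subrK.
  apply: le_trans (ler_normB _ _) _; rewrite mulrDr rmorphD; apply: lerD.
    apply: le_trans (ip_le ipN _ _) _; rewrite !rnormE -rmorphM lecR mulrA.
    by rewrite ler_wpM2r ?rnorm_ge0.
  apply: le_trans (ip_le ipN _ _) _; rewrite !rnormE -rmorphM lecR mulrCA.
  by rewrite ler_wpM2l ?rnorm_ge0.
- move=> f Ef v; have [fl _] := bE _ Ef; have [M M0 fM] := bounded_opP (bE _ Ef).
  apply: (@small_eq _ _ _ _ (rnorm (f v) + M * rnorm v)) => d /SX[S [_ _ Sf _] hS].
  have -> : X (f v) - f (X v) = (X (f v) - S (f v)) - f (X v - S v).
    have [g gE] := linear_opE fl; rewrite Sf// gE (linearB g).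
    by rewrite opprB addrA subrK.
  apply: le_trans (rnormB _ _) _; rewrite mulrDr lerD//.
  by apply: le_trans (fM _) _; rewrite mulrCA ler_wpM2l.
- move=> v; rewrite -subr_le0; apply: (@le0_small _ _ (rnorm v)).
  move=> d /SX[S [_ _ _ Sr] hS]; rewrite lerBlDr addrC -[X v](subrK (S v)).
  by apply: le_trans (rnormD _ _) _; rewrite addrC lerD.
Qed.

Lemma vna_ball0 A E (r : R) : von_neumann_algebra ip A -> E `<=` bounded_op ->
  0 <= r -> vna_ball A E r 0.
Proof.
move=> vnA bE r0; split; first exact: (vna0 vnA).
- by move=> u v; rewrite linear0l linear0r.
- by move=> f /bE[/linear_opE[g ->] _] v; rewrite (linear0 g).
- by move=> v; rewrite rnorm0 mulr_ge0 ?rnorm_ge0.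
Qed.

(** The equation says (1 - x)^2 = 1 - a. The map T -> (a + T^2) / 2 preserves the ball of radius [q]
    because q^2 <= q, and contracts by [q] because S^2 - T^2 = S (S - T) + (S - T) T. *)
Lemma vna_sqrt_near_id A E (q : R) a : von_neumann_algebra ip A ->
  E `<=` bounded_op -> 0 <= q -> q < 1 -> vna_ball A E q a ->
  exists2 x, vna_ball A E q x & forall v, x v + x v = a v + x (x v).
Proof.
move=> vnA bE q0 q1 [Aa as_ aE aq].
pose F T : H -> H := (2^-1)%:C *: (a + (T \o T)).
have half0 : 0 <= 2^-1 :> R by rewrite invr_ge0.
have [//|//|//||T||S T d|X|x xK xF] :=
  @contraction_fixpoint _ _ (vna_ball A E q) F q q.
- exact: vna_ball0.
- move=> [AT Ts TE Tq]; split.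
  + apply: (vna_scale vnA); apply: (vna_add vnA) => //; exact: (vna_comp vnA).
  + move=> u v; by rewrite /F !fctE /= ipZl ipZr_real ipDl ipDr as_ !Ts.
  + move=> f Ef v; have [fl _] := bE _ Ef; have [g gE] := linear_opE fl.
    by rewrite /F !fctE /= (aE _ Ef) !(TE _ Ef) gE (linearZ_LR g) (linearD g).
  + move=> v; rewrite /F !fctE /= rnormZ ger0_norm//.
    rewrite mulrC ler_pdivrMr//; apply: le_trans (rnormD _ _) _.
    rewrite mulr_natr mulr2n lerD//; apply: le_trans (Tq _) _.
    by rewrite -[leRHS]mul1r ler_pM ?rnorm_ge0// ltW.
- by move=> T [].
- move=> [AS Ss SE Sq] [AT Ts TE Tq] d0 ST v.
  have [g gE] := linear_opE (vna_bounded vnA AS).1.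
  rewrite /F !fctE /= -scalerBr rnormZ ger0_norm// mulrC ler_pdivrMr//.
  have -> : a v + S (S v) - (a v + T (T v)) = S (S v - T v) + (S (T v) - T (T v)).
    by rewrite gE (linearB g) -gE addrA subrK opprD addrACA subrr add0r.
  apply: le_trans (rnormD _ _) _; rewrite mulr_natr mulr2n lerD//.
    by apply: le_trans (Sq _) _; rewrite -mulrA ler_wpM2l.
  by apply: le_trans (ST _) _; rewrite [q * d]mulrC -mulrA ler_wpM2l.
- exact: vna_ball_limit.
exists x => // v; rewrite -{1 2}xF /F !fctE /= -scalerDl -rmorphD/=.
by rewrite (_ : 2^-1 + 2^-1 = 1) ?scale1r//; lra.
Qed.

(** The Neumann series of 1 - x. The radius solves r = q + q r. Adjoining [x] to [E] makes the
    iterates commute with [x], which is what keeps [x \o T] symmetric. *)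
Lemma vna_neumann A E (q : R) x : von_neumann_algebra ip A ->
  E `<=` bounded_op -> 0 <= q -> q < 1 -> vna_ball A E q x ->
  exists s, [/\ A s, symmetric_op ip s,
    (forall f, E f -> forall v, s (f v) = f (s v)) &
    forall v, s v - x (s v) = v].
Proof.
move=> vnA bE q0 q1 [Ax xs xE xq].
have q1' : 0 < 1 - q by rewrite subr_gt0.
pose r := q / (1 - q); have r0 : 0 <= r by rewrite divr_ge0// ltW.
have bx := vna_bounded vnA Ax; have [g gE] := linear_opE bx.1.
pose F T : H -> H := x + (x \o T); pose E' := E `|` [set x].
have bE' : E' `<=` bounded_op by move=> f [/bE//|->].
have [//|//|//||T||S T d|X|w [Aw ws wE _] wF] :=
  @contraction_fixpoint _ _ (vna_ball A E' r) F q r.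
- exact: vna_ball0.
- move=> [AT Ts TE Tr]; split.
  + apply: (vna_add vnA) => //; exact: (vna_comp vnA).
  + move=> u v; rewrite /F !fctE /= ipDl ipDr xs; congr (_ + _).
    by rewrite xs Ts (TE x)//; right.
  + move=> f E'f v; have [fl _] := bE' _ E'f; have [h hE] := linear_opE fl.
    rewrite /F !fctE /= (TE _ E'f) hE (linearD h) -hE.
    by case: E'f => [Ef|->//]; rewrite !(xE _ Ef).
  + move=> v; rewrite /F !fctE /=; apply: le_trans (rnormD _ _) _.
    have -> : r * rnorm v = q * rnorm v + q * (r * rnorm v).
      by rewrite /r; field; rewrite gt_eqF.
    by rewrite lerD//; apply: le_trans (xq _) _; rewrite ler_wpM2l.
- by move=> T [].
- move=> _ _ d0 ST v; rewrite /F !fctE /= opprD addrACA subrr add0r gE -(linearB g) -gE.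
  by apply: le_trans (xq _) _; rewrite -mulrA ler_wpM2l.
- exact: vna_ball_limit.
exists (idfun + w); split.
- by apply: (vna_add vnA) => //; exact: (vna_id vnA).
- by move=> u v; rewrite !fctE /= ipDl ipDr ws.
- move=> f Ef v; have [h hE] := linear_opE (bE _ Ef).1.
  by rewrite !fctE /= (wE f) ?hE ?(linearD h)//; left; rewrite -hE.
- move=> v; rewrite !fctE /= gE (linearD g) -gE.
  by rewrite -{1}wF /F !fctE /= addrK.
Qed.

(** With M above both [c] and the norm bound of [z], the operator a = 1 - z / M satisfies 0 <= a <=
    1 - c / M as a form, hence also in norm by [rnorm_symmetric_le]. Then (1 - x)^2 = z / M, and the
    inverse of 1 - x divided by the square root of M is the required operator. *)
Lemma vna_inv_sqrt A E z (c : R) : von_neumann_algebra ip A ->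
  E `<=` bounded_op -> A z -> symmetric_op ip z ->
  (forall f, E f -> forall v, z (f v) = f (z v)) ->
  0 < c -> (forall v, c * rnorm v ^+ 2 <= rip ip (z v) v) ->
  exists s, [/\ A s, symmetric_op ip s,
    (forall f, E f -> forall v, s (f v) = f (s v)) &
    forall v, z (s (s v)) = v].
Proof.
move=> vnA bE Az zs zE c0 zc.
have [M0 M0_ge0 zM] := bounded_opP (vna_bounded vnA Az).
pose M := M0 + c; have M_gt0 : 0 < M by rewrite ltr_wpDl.
have [g gE] := linear_opE (vna_bounded vnA Az).1.
pose a : H -> H := idfun - (M^-1)%:C *: z; pose q := 1 - c / M.
have q0 : 0 <= q by rewrite subr_ge0 ler_pdivrMr// mul1r lerDr.
have q1 : q < 1 by rewrite ltrBlDr ltrDl divr_gt0.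
have aE v : a v = v - (M^-1)%:C *: z v by [].
have aA : A a by apply: (vna_sub vnA); [exact: (vna_id vnA)|exact: (vna_scale vnA)].
have a_sym : symmetric_op ip a.
  move=> u v; by rewrite !aE linearBl linearBr /= ipZl ipZr_real zs.
have ripa v : rip ip (a v) v = rnorm v ^+ 2 - M^-1 * rip ip (z v) v.
  by rewrite aE ripDl ripNl ripZl rip_rnorm.
have rip_a v : rip ip (a v) v <= q * rnorm v ^+ 2.
  by rewrite ripa /q mulrBl mul1r lerB// -mulrA mulrCA ler_wpM2l ?invr_ge0 ?(ltW M_gt0).
have a_pos v : 0 <= rip ip (a v) v.
  rewrite ripa subr_ge0 mulrC ler_pdivrMr// mulrC; apply: le_trans (rip_le_rnorm _ _) _.
  rewrite expr2 mulrA ler_wpM2r ?rnorm_ge0//; apply: le_trans (zM v) _.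
  by rewrite ler_wpM2r ?rnorm_ge0// lerDl ltW.
have aq v : rnorm (a v) <= q * rnorm v.
  rewrite -(@ler_pXn2r _ 2)// ?nnegrE ?mulr_ge0 ?rnorm_ge0//.
  have := rnorm_symmetric_le (vna_bounded vnA aA).1 a_sym a_pos rip_a v.
  by move=> /le_trans; apply; rewrite exprMn expr2 -mulrA ler_wpM2l.
have aE' f : E f -> forall v, a (f v) = f (a v).
  move=> Ef v; have [h hE] := linear_opE (bE _ Ef).1.
  by rewrite !aE (zE _ Ef) hE (linearB h) (linearZ_LR h).
have [x xK xx] := vna_sqrt_near_id vnA bE q0 q1 (And4 aA a_sym aE' aq).
have [s [As ss sE sx]] := vna_neumann vnA bE q0 q1 xK.
have [y yE] := linear_opE (vna_bounded vnA (let: And4 Ax _ _ _ := xK in Ax)).1.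
have uu v : (v - x v) - x (v - x v) = (M^-1)%:C *: z v.
  rewrite yE (linearB y) -yE opprB addrACA -opprD xx aE.
  by rewrite [v - _ + _]addrAC subKr.
have [t tE] := linear_opE (vna_bounded vnA As).1.
exists ((Num.sqrt M)^-1%:C *: s); split.
- exact: (vna_scale vnA).
- move=> u v; by rewrite !fctE /= ipZl ipZr_real ss.
- move=> f Ef v; have [h hE] := linear_opE (bE _ Ef).1.
  by rewrite !fctE /= (sE _ Ef) hE (linearZ_LR h).
- move=> v; rewrite !fctE /= tE (linearZ_LR t) -tE gE !(linearZ_LR g) -gE.
  rewrite scalerA -rmorphM/= -invfM -expr2 sqr_sqrtr ?ltW//.
  by rewrite -uu !sx.
Qed.

End InverseSquareRoot.

(** * Block decomposition and the induction on blocks *)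

Section TriangularFactorization.
Context {R : realType} {H : completeNormedModType R[i]}.
Variables (ip : {dot H for @Num.conj R[i]}) (ipN : norm_of_ip ip).
Variables (A : set (H -> H)) (vnA : von_neumann_algebra ip A).
Implicit Types (u v : H) (S T : H -> H).

Lemma vna_appD T (AT : A T) u v : T (u + v) = T u + T v.
Proof. by have [/linear_opE[f ->] _] := vna_bounded vnA AT; rewrite (linearD f). Qed.

Lemma vna_appB T (AT : A T) u v : T (u - v) = T u - T v.
Proof. by have [/linear_opE[f ->] _] := vna_bounded vnA AT; rewrite (linearB f). Qed.

Lemma vna_app0 T (AT : A T) : T 0 = 0.
Proof. by have [/linear_opE[f ->] _] := vna_bounded vnA AT; rewrite (linear0 f). Qed.

Lemma projection_symmetric T :
  orthogonal_projection ip T -> symmetric_op ip T.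
Proof. by move=> [bT _ adjT]; have [_] := adjointP ipN bT; rewrite adjT. Qed.

Lemma rip_projection T v : symmetric_op ip T -> (forall u, T (T u) = T u) ->
  rip ip (T v) v = rnorm (T v) ^+ 2.
Proof. by move=> Ts TT; rewrite -(rip_rnorm ipN) /rip [in RHS]Ts TT -Ts. Qed.

Variables (n : nat) (e : 'I_n -> H -> H).
Hypotheses (eA : forall i, A (e i)) (es : forall i, symmetric_op ip (e i)).
Hypotheses (ee : forall i v, e i (e i v) = e i v).
Hypothesis (e1 : forall v, \sum_(i < n) e i v = v).

Lemma sum_rnorm_projections v :
  \sum_(i < n) rnorm (e i v) ^+ 2 = rnorm v ^+ 2.
Proof.
rewrite -(rip_rnorm ipN v) -{2}(e1 v).
have rip0 : rip ip 0 v = 0 by rewrite /rip linear0l.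
rewrite (big_morph (fun w => rip ip w v) (fun a b => ripDl ip a b v) rip0).
by apply: eq_bigr => i _; rewrite rip_projection.
Qed.

(** In the Pythagorean identity for [e j v], the term of index [j] already exhausts the total, so
    all the others vanish. *)
Lemma projections_orthogonal i j v : i != j -> e i (e j v) = 0.
Proof.
move=> ij; apply: rnorm_eq0; apply/eqP; rewrite -sqrf_eq0; apply/eqP.
have := sum_rnorm_projections (e j v); rewrite (bigD1 j)//= ee.
rewrite -[X in _ = X]addr0 => /addrI/eqP.
rewrite psumr_eq0 => [/allP/(_ i)|l _]; last exact: sqr_ge0.
by rewrite mem_index_enum ij => /(_ isT)/eqP.
Qed.

(** The adjoint is carried along as the witness [w]. That [x] vanishes on both sides of the blocks
    from k on is part of the induction: it kills the cross terms with the next column. *)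
Lemma triangular_factor (c : R) : 0 < c -> c <= 1 ->
  forall k y, (k <= n)%N -> A y -> symmetric_op ip y ->
  (forall i : 'I_n, (k <= i)%N -> forall v, e i (y v) = 0) ->
  (forall v,
     c * (\sum_(i < n | (i < k)%N) rnorm (e i v) ^+ 2) <= rip ip (y v) v) ->
  exists x w, [/\ A x, A w, forall u v, ip (x u) v = ip u (w v),
    forall v, y v = x (w v) &
    [/\ forall i : 'I_n, (k <= i)%N -> forall v, e i (x v) = 0,
        forall i : 'I_n, (k <= i)%N -> forall v, x (e i v) = 0 &
        forall i j : 'I_n, (j < i)%N -> forall v, e i (x (e j v)) = 0]].
Proof.
move=> c0 c1; elim=> [|k IHk] y kn Ay ys yk yc.
  exists 0, 0; have A0 := vna0 vnA; split=> //.
  - by move=> u v; rewrite linear0l linear0r.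
  - by move=> v; rewrite -[LHS]e1 big1// => i _; exact: yk.
  - by split=> [i _ v|//|i j _ v]; rewrite vna_app0.
pose p := e (Ordinal kn).
have Ap : A p by exact: eA.
have ps : symmetric_op ip p by exact: es.
have pp v : p (p v) = p v by exact: ee.
have ep (i : 'I_n) v : i != k :> nat -> e i (p v) = 0.
  by move=> ik; apply: projections_orthogonal; apply: contra ik => /eqP->.
have pe (i : 'I_n) v : i != k :> nat -> p (e i v) = 0.
  by move=> ik; apply: projections_orthogonal; apply: contra ik => /eqP<-.
(* Adding 1 - p to the corner makes it invertible on all of [H]. *)
pose z : H -> H := (p \o y \o p) + (idfun - p).
have zE v : z v = p (y (p v)) + (v - p v) by [].
have Az : A z.
  apply: (vna_add vnA).
    by apply: (vna_comp vnA) => //; exact: (vna_comp vnA).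
  by apply: (vna_sub vnA) => //; exact: (vna_id vnA).
have zs : symmetric_op ip z.
  by move=> u v; rewrite !zE ipDl ipDr linearBl linearBr /= ps ys ps ps.
have zp v : z (p v) = p (z v).
  by rewrite !zE (vna_appD Ap) (vna_appB Ap) !pp !subrr.
have pN v : rnorm (p v) ^+ 2 <= rnorm v ^+ 2.
  rewrite -subr_ge0; have : 0 <= rip ip (v - p v) (v - p v).
    by rewrite (rip_rnorm ipN) sqr_ge0.
  rewrite ripDl !ripDr !ripNl !ripNr opprK (ripC ip v (p v)) !rip_projection//.
  by rewrite !(rip_rnorm ipN); lra.
have zc v : c * rnorm v ^+ 2 <= rip ip (z v) v.
  rewrite zE !ripDl ripNl rip_projection// (rip_rnorm ipN).
  have -> : rip ip (p (y (p v))) v = rip ip (y (p v)) (p v) by rewrite /rip ps.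
  have : c * rnorm (p v) ^+ 2 <= rip ip (y (p v)) (p v).
    apply: le_trans (yc (p v)); rewrite ler_pM2l//.
    rewrite (bigD1 (Ordinal kn)) //= -/p pp lerDl.
    by apply: sumr_ge0 => i _; exact: sqr_ge0.
  (* On the range of 1 - p the form of [z] is that of the identity, so [c <= 1] is what lets [c]
     bound it there too. *)
  have : 0 <= (1 - c) * (rnorm v ^+ 2 - rnorm (p v) ^+ 2) by rewrite mulr_ge0 ?subr_ge0.
  by lra.
have [||s [As ss sp zss]] := vna_inv_sqrt (E := [set p]) ipN vnA _ Az zs _ c0 zc.
- by move=> _ ->; exact: (vna_bounded vnA).
- by move=> _ -> v; exact: zp.
have {}sp v : s (p v) = p (s v) by exact: sp.
(* [t] is (p y p)^-1 p y: it selects the vector of block k for which p y (v - t v) = 0. *)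
pose t v := s (s (p (y v))).
have At : A (s \o (s \o (p \o y))) by do 3?apply: (vna_comp vnA) => //.
have pt v : p (t v) = t v by rewrite /t -!sp pp.
have pyt v : p (y (t v)) = p (y v).
  by rewrite -[RHS]zss -/(t v) zE pt subrr addr0.
pose y' : H -> H := y - (y \o t).
have y'E v : y' v = y v - y (t v) by [].
have Ay' : A y' by apply: (vna_sub vnA) => //; exact: (vna_comp vnA).
have y's : symmetric_op ip y'.
  move=> u v; rewrite !y'E linearBl linearBr /= ys; congr (_ - _).
  by rewrite ys /t !ss ps ys -!sp.
have py' v : p (y' v) = 0 by rewrite y'E (vna_appB Ap) pyt subrr.
have y'k (i : 'I_n) : (k <= i)%N -> forall v, e i (y' v) = 0.
  rewrite leq_eqVlt => /predU1P[ki v|ki v].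
    by rewrite (_ : i = Ordinal kn) ?py'//; apply: val_inj.
  by rewrite y'E (vna_appB (eA i)) !yk// subrr.
have y'c v : c * (\sum_(i < n | (i < k)%N) rnorm (e i v) ^+ 2) <= rip ip (y' v) v.
  (* Since [p] kills [y' v] and [t v] lies in the range of [p], subtracting [t v] in the second
     argument changes nothing. *)
  have -> : rip ip (y' v) v = rip ip (y (v - t v)) (v - t v).
    rewrite (vna_appB Ay) -y'E ripDr ripNr -pt.
    have -> : rip ip (y' v) (p (t v)) = rip ip (p (y' v)) (t v) by rewrite /rip ps.
    by rewrite py' /rip linear0l subr0.
  apply: le_trans (yc _); rewrite ler_pM2l//.
  rewrite [leRHS](bigD1 (Ordinal kn)) //= -[leLHS]add0r lerD ?sqr_ge0//.
  rewrite le_eqVlt; apply/orP; left; apply/eqP; apply: eq_big => [i|i ik].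
    by rewrite -val_eqE /= ltnS ltn_neqAle andbC.
  by rewrite (vna_appB (eA i)) -pt ep ?subr0// ltn_eqF.
have [x [w [Ax Aw xw y'xw [xk1 xk2 xt]]]] := IHk y' (ltnW kn) Ay' y's y'k y'c.
(* [xp] and [pw] remove the two cross terms in the product of [x] plus the new column with its
   adjoint. *)
have xp v : x (p v) = 0 by exact: xk2.
have pw v : p (w v) = 0.
  by apply: (ip_inj (ip := ip)) => u; rewrite -ps -xw xp linear0l linear0r.
exists (x + (y \o s \o p)), (w + (p \o s \o y)); split.
- apply: (vna_add vnA) => //; apply: (vna_comp vnA) => //; exact: (vna_comp vnA).
- apply: (vna_add vnA) => //; apply: (vna_comp vnA) => //; exact: (vna_comp vnA).
- by move=> u v; rewrite !fctE /= ipDl ipDr xw ys ss ps.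
- move=> v; rewrite !fctE /= (vna_appD Ax) !(vna_appD Ap) xp pw add0r -y'xw.
  by rewrite addr0 y'E /t !pp -!sp subrK.
- split=> [i ki v|i ki v|i j ji v]; rewrite !fctE /=.
  + by rewrite (vna_appD (eA i)) xk1 1?ltnW// yk// addr0.
  + by rewrite xk2 1?ltnW// pe ?gtn_eqF// (vna_app0 As) (vna_app0 Ay) addr0.
  + rewrite (vna_appD (eA i)) xt// add0r; have [jk|jk] := eqVneq (j : nat) k.
      by rewrite yk// -jk.
    by rewrite pe// !vna_app0.
Qed.

End TriangularFactorization.

(** * Lower bound for strictly positive operators, and the conclusion *)

Lemma strictly_positive_lower_bound (R : realType)
    (H : completeNormedModType R[i]) (ip : {dot H for @Num.conj R[i]})
    (ipN : norm_of_ip ip) (y : H -> H) : strictly_positive_op ip y ->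
  exists c : R, [/\ 0 < c, c <= 1 &
    forall v, c * rnorm v ^+ 2 <= rip ip (y v) v].
Proof.
move=> [y_pos [S bS [_ Sy]]]; have [by_ y0] := y_pos.
have [b b0 yb] := bounded_opP by_; have [M M0 SM] := bounded_opP bS.
have rip_y0 v : 0 <= rip ip (y v) v by rewrite -lecR RRe_real ?ger0_real ?y0.
have rip_yb v : rip ip (y v) v <= b * rnorm v ^+ 2.
  apply: le_trans (rip_le_rnorm ipN _ _) _.
  by rewrite expr2 mulrA ler_wpM2r ?rnorm_ge0.
(* This gives |y v|^2 <= b <y v, v>; with |v| <= M |y v| from the inverse, |v|^2 <= M^2 b <y v, v>.
   The extra 1 in the denominator below keeps the constant at most 1. *)
have yb2 := rnorm_symmetric_le ipN by_.1 (positive_symmetric y_pos) rip_y0 rip_yb.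
have K0 : 0 < M ^+ 2 * b + 1 by rewrite ltr_wpDl// mulr_ge0// sqr_ge0.
exists (M ^+ 2 * b + 1)^-1; split; first by rewrite invr_gt0.
  by rewrite invf_le1// lerDr mulr_ge0// sqr_ge0.
move=> v; rewrite mulrC ler_pdivrMr// mulrC mulrDl mul1r -[leLHS]addr0 lerD//.
have vE : v = S (y v) by rewrite -[RHS]/((S \o y) v) Sy.
apply: le_trans (_ : M ^+ 2 * rnorm (y v) ^+ 2 <= _).
  by rewrite -exprMn lerXn2r ?nnegrE ?mulr_ge0 ?rnorm_ge0// {1}vE.
by rewrite -[leRHS]mulrA ler_wpM2l ?sqr_ge0.
Qed.

Theorem lemma21 (R : realType) (H : completeNormedModType R[i])
    (ip : {dot H for @Num.conj R[i]}) (ip_norm : norm_of_ip ip)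
    (A : set (H -> H)) (vnA : von_neumann_algebra ip A)
    (n : nat) (e : 'I_n -> H -> H)
    (eA : forall i, A (e i))
    (e_proj : forall i, orthogonal_projection ip (e i))
    (e_sum : \sum_(i < n) e i = idfun)
    (y : H -> H) (yA : A y) (y_pos : strictly_positive_op ip y) :
  exists x : H -> H,
    [/\ A x,
        y = x \o adjoint ip x &
        forall i j : 'I_n, (j < i)%N -> e i \o x \o e j = 0].
Proof.
have es i := projection_symmetric ip_norm (e_proj i).
have ee i v : e i (e i v) = e i v.
  by have [_ + _] := e_proj i => /(congr1 (@^~ v)).
have e1 v : \sum_(i < n) e i v = v.
  by have := congr1 (@^~ v) e_sum; rewrite fct_sumE.
have [c [c0 c1 yc]] := strictly_positive_lower_bound ip_norm y_pos.
have [i|v|x [w [Ax Aw xw yE [_ _ x_tri]]]] :=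
  triangular_factor ip_norm vnA eA es ee e1 c0 c1 (leqnn n) yA
    (positive_symmetric y_pos.1).
- by rewrite leqNgt ltn_ord.
- rewrite (eq_bigl xpredT) => [|i]; last exact: ltn_ord.
  by rewrite (sum_rnorm_projections ip_norm es ee e1).
have bx := vna_bounded vnA Ax.
(* Uniqueness of adjoints identifies the witness carried by the induction with [adjoint ip x]. *)
have wE : adjoint ip x = w.
  apply: (is_adjoint_uniq (adjointP ip_norm bx)).
  by split=> //; exact: (vna_bounded vnA Aw).
exists x; split=> //.
  by apply/funext => v; rewrite wE /= yE.
by move=> i j ji; apply/funext => v; exact: x_tri.
Qed.
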